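(* Let $r,i,j\ge 0$ be integers, let $G=G(r,i,j)$, let $n=i+j+r+2$ be its number of vertices, and let $k=|D(G)|/2$. Then $$\lambda_2(G)\ \ge\ \frac{n-k+1-\sqrt{(n-k+1)^2-4(n-2k)}}{2}.$$
   Context: Graphs are finite, simple and undirected. The Laplacian of a graph on $n$ vertices is $L=\Delta-A$, where $\Delta$ is the diagonal matrix of degrees and $A$ is the adjacency matrix; its eigenvalues are listed as $0=\lambda_1(G)\le\lambda_2(G)\le\cdots\le\lambda_n(G)$ with multiplicity. $d(x,v)$ denotes graph distance and $D(G)=\{v\in V(G): \text{there is some } x\in V(G)\text{ with } d(x,v)\ge 3\}$. The graph $G(r,i,j)$, on $n=i+j+r+2$ vertices, is obtained as follows: begin with an edge between vertices $a$ and $b$; add $r$ new vertices each adjacent to exactly $a$ and $b$; add $i$ new vertices each adjacent only to $a$; and add $j$ new vertices each adjacent only to $b$. *)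

(* Defs.v *)
From mathcomp Require Import all_boot all_order all_algebra.
From mathcomp Require Import complex polyrcf.
Set Implicit Arguments.
Unset Strict Implicit.
Unset Printing Implicit Defensive.
Import Order.TTheory GRing.Theory Num.Theory.
Local Open Scope ring_scope.

Record sgraph := SGraph {
  vertex :> finType;
  edge : rel vertex;
  edge_sym : symmetric edge;
  edge_irrefl : irreflexive edge }.

Definition degree (G : sgraph) (x : G) : nat := #|[set y | edge x y]|.

(* Length of a shortest walk from x to y. A finite distance is smaller than
   #|G|; when x and y are in different components the value is #|G|. *)
Definition dist (G : sgraph) (x y : G) : nat :=
  find (fun m => [exists p : m.-tuple G, path (@edge G) x p && (last x p == y)])
       (iota 0 #|G|).

Definition D (G : sgraph) : {set G} := [set v | [exists x, (3 <= dist x v)%N]].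

Definition adjacency_mx (R : pzRingType) (G : sgraph) : 'M[R]_#|G| :=
  \matrix_(i, j) (edge (enum_val i) (enum_val j))%:R.

Definition degree_mx (R : pzRingType) (G : sgraph) : 'M[R]_#|G| :=
  diag_mx (\row_i (degree (enum_val i))%:R).

Definition laplacian (R : pzRingType) (G : sgraph) : 'M[R]_#|G| :=
  degree_mx R G - adjacency_mx R G.

(* The roots in R of the characteristic polynomial, in increasing order, each
   repeated according to its multiplicity. *)
Definition spectrum (R : rcfType) (n : nat) (A : 'M[R]_n) : seq R :=
  sort <=%R (flatten [seq nseq (mup x (char_poly A)) x
                     | x <- rootsR (char_poly A)]).

(* Numbered from 1: lambda R G 1 <= lambda R G 2 <= ... <= lambda R G #|G|. *)
Definition lambda (R : rcfType) (G : sgraph) (m : nat) : R :=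
  (spectrum (laplacian R G))`_m.-1.

Section G_rij.
Variables r i j : nat.

(* inl false and inl true are the vertices a and b. *)
Definition G_vertex : finType := (bool + ('I_r + ('I_i + 'I_j)))%type.

Definition G_arc (x y : G_vertex) : bool :=
  match x, y with
  | inl false, inl true => true
  | inl _, inr (inl _) => true
  | inl c, inr (inr (inl _)) => ~~ c
  | inl c, inr (inr (inr _)) => c
  | _, _ => false
  end.

Definition G_edge (x y : G_vertex) : bool := G_arc x y || G_arc y x.

Lemma G_edge_sym : symmetric G_edge.
Proof. by move=> x y; rewrite /G_edge orbC. Qed.

Lemma G_edge_irrefl : irreflexive G_edge.
Proof. by case=> [[]|x]. Qed.

Definition G_rij : sgraph := SGraph G_edge_sym G_edge_irrefl.

Lemma card_G_rij : #|G_rij| = (i + j + r + 2)%N.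
Proof.
by rewrite !card_sum card_bool !card_ord addnC [(r + _)%N]addnC.
Qed.

End G_rij.

Lemma laplacian_sym (R : pzRingType) (G : sgraph) :
  (laplacian R G)^T = laplacian R G.
Proof.
apply/matrixP=> x y; rewrite !mxE edge_sym; congr (_ - _).
by rewrite eq_sym; case: eqP => // ->.
Qed.

Lemma spectrum_sorted (R : rcfType) (n : nat) (A : 'M[R]_n) :
  sorted <=%R (spectrum A).
Proof. exact/sort_sorted/le_total. Qed.

Lemma perm_roots (R : rcfType) (s : seq R) :
  let p := \prod_(x <- s) ('X - x%:P) in
  perm_eq s (flatten [seq nseq (mup x p) x | x <- rootsR p]).
Proof.
set p := \prod_(x <- s) _ => /=.
have p0 : p != 0 by rewrite monic_neq0 ?monic_prod_XsubC.
have mupE x : mup x p = count_mem x s.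
  rewrite /p {p0 p}; elim: s => [|y s IHs] /=.
    by rewrite big_nil mupNroot ?root1.
  rewrite big_cons mupM ?polyXsubC_eq0 //; last first.
    by rewrite monic_neq0 ?monic_prod_XsubC.
  by rewrite IHs -(expr1 ('X - y%:P)) mup_XsubCX; case: (y == x).
apply/allP=> x _ /=; apply/eqP; rewrite -[LHS](mupE x) count_flatten -map_comp.
rewrite sumnE big_map.
under eq_bigr => y _ do rewrite /= count_nseq /=.
have uR : uniq (rootsR p) by rewrite uniq_roots.
have inR : (x \in rootsR p) = root p x.
  by rewrite -roots_on_rootsR // in_itv.
have [rx|nrx] := boolP (root p x).
  rewrite (bigD1_seq x) ?inR //= eqxx mul1n big1 ?addn0 // => y /negPf->.
  by rewrite mul0n.
rewrite mupNroot // big1_seq // => y /andP[_ yR].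
have [eyx|] := eqVneq y x; last by rewrite mul0n.
by rewrite eyx mul1n mupNroot.
Qed.

(* A real symmetric matrix has all its eigenvalues in R, so its spectrum is
   the full list of its n eigenvalues. *)
Lemma char_poly_spectrum (R : rcfType) (n : nat) (A : 'M[R]_n) :
  A^T = A -> char_poly A = \prod_(x <- spectrum A) ('X - x%:P).
Proof.
move=> symA; pose f := real_complex R; pose B := map_mx f A.
suff [s sE] : exists s : seq R, char_poly A = \prod_(x <- s) ('X - x%:P).
  rewrite {1}sE; apply: perm_big; rewrite /spectrum sE.
  by apply: perm_trans (perm_roots s) _; rewrite perm_sym perm_sort.
have hB : B \is hermsymmx.
  apply: realsym_hermsym.
    by apply/is_hermitianmxP; rewrite expr0 scale1r map_mx_id // map_trmx symA.
  by apply/mxOverP=> x y; rewrite mxE complex_real.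
pose d := spectral_diag B.
have /mxOverP dR := hermitian_spectral_diag_real hB.
have dE x : d 0 x = f (complex.Re (d 0 x)).
  by have := dR 0 x; rewrite -/d => /RRe_real /esym.
exists [seq complex.Re (d 0 x) | x : 'I_n].
apply: (map_poly_inj f).
rewrite map_char_poly -/B rmorph_prod /= big_map big_enum /=.
have /orthomx_spectralP BE := hermitian_normalmx hB.
have -> : char_poly B = char_poly (diag_mx d).
  pose PX := map_mx polyC (spectralmx B).
  pose QX := map_mx polyC (invmx (spectralmx B)).
  have QP : QX *m PX = 1%:M by rewrite -map_mxM mulVmx ?spectral_unit ?map_mx1.
  have -> : char_poly B = \det (QX *m char_poly_mx (diag_mx d) *m PX).
    rewrite /char_poly; congr (\det _).
    rewrite /char_poly_mx {1}BE mulmxBr mulmxBl scalar_mxC -(mulmxA _ QX) QP.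
    by rewrite mulmx1 !map_mxM.
  by rewrite !det_mulmx mulrAC -det_mulmx QP det1 mul1r.
rewrite char_poly_trig ?diag_mx_is_trig //.
apply: eq_bigr => x _; rewrite mxE eqxx mulr1n map_polyXsubC /=.
by rewrite {1}dE.
Qed.

(* Main.v *)
(* Adding the all-ones matrix J to the Laplacian L moves one zero eigenvalue to
   |G| and keeps all the others, so lambda_2 < c with c < |G| yields an
   eigenvector x of L with eigenvalue mu < c and coordinate sum 0.  For
   G(r,i,j) and mu < 1, the values of x off {a, b} are determined by x a and
   x b.  With q = (2 + r - mu)(1 - mu), the equations at a and b and the zero
   sum give
     (q + i (1 - mu)) x_a = - j x_b,   (q + j (1 - mu)) x_b = - i x_a,
   so x = 0 unless (q + i (1 - mu)) (q + j (1 - mu)) = i j.  When i, j > 0 the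
   i + j pendant vertices lie in D(G), and if h = (i + j) / 2 and mu is below
   the bound then q > h mu; the determinant of this system is then positive,
   since i j <= h^2.  When i j = 0, mu < 1 suffices for this. *)
Require Import Defs.
From mathcomp Require Import all_boot all_order all_algebra.
From mathcomp Require Import ring lra.
Import Order.TTheory GRing.Theory Num.Theory.
Local Open Scope ring_scope.

Lemma char_poly_rank1_shift (R : comNzRingType) (n : nat) (A : 'M[R]_n)
    (w : 'rV[R]_n) :
  A *m w^T = 0 ->
  'X * char_poly (A + w^T *m w) = ('X - ((w *m w^T) 0 0)%:P) * char_poly A.
Proof.
(* Compute the determinant of [[1, w], [w^T, X - A]] by eliminating w^T with
   the block 1, then with the block X - A, which maps w^T to X w^T. *)
move=> Aw0; pose W := map_mx polyC w.
have AW0 : map_mx polyC A *m W^T = 0 by rewrite map_trmx -map_mxM Aw0 map_mx0.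
pose M := block_mx 1%:M W W^T (char_poly_mx A).
have detM : \det M = char_poly (A + w^T *m w).
  have : block_mx 1%:M 0 (- W^T) 1%:M *m M
         = block_mx 1%:M W 0 (char_poly_mx (A + w^T *m w)).
    rewrite mulmx_block !mul1mx !mul0mx !addr0 mulmx1 addNr mulNmx.
    by rewrite /char_poly_mx map_mxD map_mxM map_trmx addrC opprD addrA.
  move/(congr1 determinant).
  by rewrite det_mulmx det_lblock det_ublock !det1 !mul1r.
have : M *m block_mx ('X%:M) 0 (- W^T) 1%:M
       = block_mx ('X%:M - W *m W^T) W 0 (char_poly_mx A).
  rewrite mulmx_block !mul1mx !mulmx0 !add0r !mulmx1 !mulmxN.
  by rewrite /char_poly_mx mulmxBl AW0 subr0 mul_mx_scalar mul_scalar_mx subrr.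
move/(congr1 determinant).
rewrite det_mulmx det_lblock det_ublock det1 mulr1 detM !det_mx11 mulrC.
by rewrite map_trmx -map_mxM !mxE eqxx mulr1n.
Qed.

Section Lambda2.
Variables (R : rcfType) (G : sgraph).
Implicit Types (x : G -> R) (v : G).

(** The Laplacian as an operator on functions on the vertices, so that eigenvector equations can be
    read off vertex by vertex without ordinal indices. *)
Definition laplace x v : R := \sum_u (edge v u)%:R * (x v - x u).

Lemma laplacianE (z : 'rV[R]_#|G|) v :
  (z *m laplacian R G) 0 (enum_rank v) = laplace (fun u => z 0 (enum_rank u)) v.
Proof.
rewrite mxE (reindex_onto enum_rank enum_val) /=; last by move=> ? _; rewrite enum_valK.
under eq_bigl do rewrite enum_rankK eqxx.
under eq_bigr do rewrite !mxE !enum_rankK mulrBr.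
rewrite sumrB /laplace.
under [RHS]eq_bigr do rewrite mulrBr.
rewrite sumrB; congr (_ - _); last first.
  by apply: eq_bigr => u _; rewrite edge_sym mulrC.
rewrite (bigD1 v) //= eqxx mulr1n big1 => [|u uv]; last first.
  by rewrite (inj_eq enum_rank_inj) (negPf uv) mulr0n mulr0.
rewrite addr0 -mulr_suml mulrC; congr (_ * _).
rewrite /degree -sum1_card big_mkcond natr_sum /=; apply: eq_bigr => u _.
by rewrite inE; case: edge.
Qed.

Lemma laplacian_ones : laplacian R G *m (const_mx 1 : 'rV_#|G|)^T = 0.
Proof.
rewrite -[laplacian R G]laplacian_sym -trmx_mul; apply/colP => s.
rewrite [LHS]mxE -[s]enum_valK laplacianE [RHS]mxE.
by apply: big1 => u _; rewrite !mxE subrr mulr0.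
Qed.

Lemma lambda2_ge (c : R) :
  (1 < #|G|)%N -> c < #|G|%:R ->
  (forall (mu : R) x, mu < c -> \sum_v x v = 0 ->
     (forall v, laplace x v = mu * x v) -> forall v, x v = 0) ->
  c <= lambda R G 2.
Proof.
move=> G1 cG Hc; rewrite leNgt; apply/negP => l2c.
pose w : 'rV[R]_#|G| := const_mx 1; pose L := laplacian R G.
pose L' := L + w^T *m w.
have symL' : L'^T = L' by rewrite linearD /= trmx_mul trmxK laplacian_sym.
have ww : (w *m w^T) 0 0 = #|G|%:R.
  by rewrite mxE; under eq_bigr do rewrite !mxE mulr1; rewrite sumr_const card_ord.
have := char_poly_rank1_shift _ _ _ _ laplacian_ones.
rewrite -/w ww -/L -/L' (char_poly_spectrum symL').
rewrite (char_poly_spectrum (laplacian_sym R G)) -[X in X * _]subr0 -polyC0.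
rewrite -!(big_cons _ _ _ _ xpredT (fun mu => 'X - mu%:P)) => pE.
have peq : perm_eq (0 :: spectrum L') (#|G|%:R :: spectrum L).
  have := perm_roots (0 :: spectrum L'); rewrite /= pE => /perm_trans; apply.
  by rewrite perm_sym; apply: (perm_roots (_ :: spectrum L)).
have nol mu : mu < c -> mu \notin spectrum L'.
  move=> muc; apply/negP => mus.
  have : root (char_poly L') mu by rewrite char_poly_spectrum // root_prod_XsubC.
  rewrite -eigenvalue_root_char => /eigenvalueP[z zE]; apply/negP; rewrite negbK.
  pose x v := z 0 (enum_rank v).
  have zw : z *m w^T = (\sum_v x v)%:M.
    apply/matrixP => s t; rewrite !ord1 !mxE eqxx mulr1n.
    rewrite (reindex_onto enum_rank enum_val) /=; last by move=> ? _; rewrite enum_valK.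
    under eq_bigl do rewrite enum_rankK eqxx.
    by apply: eq_bigr => u _; rewrite !mxE mulr1.
  (* Multiplying [zE] by [w^T], which [L] kills, gives [|G| S = mu S] for the coordinate sum [S],
     and [mu < c < |G|]. *)
  have S0 : \sum_v x v = 0.
    have /(congr1 (fun A => (A *m w^T) 0 0)) := zE.
    rewrite mulmxDr mulmxDl -mulmxA laplacian_ones mulmx0 add0r -!mulmxA.
    rewrite mulmxA zw -scalemxAl zw mul_scalar_mx mxE ww !mxE eqxx mulr1n mulrC.
    move/eqP; rewrite -subr_eq0 -mulrBl mulf_eq0 subr_eq0.
    by rewrite (gt_eqF (lt_trans muc cG)) => /eqP.
  have zL v : laplace x v = mu * x v.
    have w0 : z *m (w^T *m w) = 0 by rewrite mulmxA zw S0 raddf0 mul0mx.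
    by rewrite -laplacianE -[z *m _]addr0 -w0 -mulmxDr zE mxE.
  apply/eqP/rowP => s; rewrite mxE -[s]enum_valK.
  exact: (Hc mu x).
(* Ensures that [lambda R G 2] is a true entry of the list and not the default value 0. *)
have szL : (1 < size (spectrum L))%N.
  rewrite (_ : size _ = #|G|) //; apply: succn_inj.
  rewrite -(size_prod_XsubC _ id) -char_poly_spectrum ?laplacian_sym //.
  by rewrite size_char_poly.
have := spectrum_sorted L; rewrite -/L; move: l2c; rewrite /lambda -/L /=.
(* Count the entries below [c] on both sides: at most one on the left, the added 0, but at least two
   on the right, [l1] and [l2]. *)
have /permP/(_ (fun mu => mu < c)) /= := peq.
have -> : count (fun mu => mu < c) (spectrum L') = 0%N.
  apply/eqP; rewrite -leqn0 leqNgt -has_count.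
  by apply/hasP => -[mu mus /nol]; rewrite mus.
move: szL; case: (spectrum L) => [|l1 [|l2 s]] //= _ cnt l2c /andP[l12 _].
move: cnt; rewrite l2c (le_lt_trans l12 l2c) (lt_gtF cG).
by case: (_ < _).
Qed.

End Lambda2.
Arguments laplace {R G}.

(** Walks of length 0, 1 and 2 are excluded in turn. Since [dist] never exceeds [#|G|], the value 3
    requires [2 < #|G|]. *)
Lemma dist_ge3 (G : sgraph) (x y : G) :
  (2 < #|G|)%N -> x != y -> ~~ edge x y ->
  (forall z, ~~ (edge x z && edge z y)) -> (3 <= dist x y)%N.
Proof.
move=> G2 xy exy exzy; rewrite leqNgt; apply/negP; rewrite /dist.
set f := fun m => _; set s := iota _ _ => lt3.
have fs : (find f s < size s)%N by rewrite size_iota (leq_trans lt3).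
have := nth_find 0%N; move=> /(_ f s); rewrite has_find => /(_ fs).
rewrite /s nth_iota -/s ?add0n; last by rewrite -[X in (_ < X)%N](size_iota 0).
case: (find f s) lt3 => [|[|[|]]] // _ /existsP[p].
- by rewrite tuple0 /= (negPf xy).
- case/tupleP: p => u p; rewrite tuple0 /= andbT => /andP[xu /eqP uy].
  by rewrite -uy xu in exy.
case/tupleP: p => u p; case/tupleP: p => t p; rewrite tuple0 /= andbT.
move=> /andP[/andP[xu ut] /eqP ty]; have := exzy u.
by rewrite xu -ty ut.
Qed.

(** A walk between a pendant vertex at [a] and one at [b] must pass through both [a] and [b], so any
    pendant vertex on the opposite side is a witness. *)
Lemma leq_card_D_G_rij (r i j : nat) :
  (0 < i)%N -> (0 < j)%N -> (i + j <= #|D (G_rij r i j)|)%N.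
Proof.
move=> i0 j0.
pose f (p : 'I_i + 'I_j) : G_rij r i j := inr (inr p).
have f_inj : injective f by move=> ? ? [].
have card2 : (2 < #|G_rij r i j|)%N by rewrite card_G_rij addn2 !ltnS !addn_gt0 i0.
rewrite -{1}(card_ord i) -{1}(card_ord j) -card_sum.
rewrite -(card_imset _ f_inj) subset_leq_card //; apply/subsetP => _ /imsetP[p _ ->].
rewrite inE; apply/existsP.
case: p => [p|p].
  exists (f (inr (Ordinal j0))); apply: dist_ge3 => //.
  by case=> [[]|[|[]]].
exists (f (inl (Ordinal i0))); apply: dist_ge3 => //.
by case=> [[]|[|[]]].
Qed.

Lemma G_rij_eigenvector_eq0 (R : rcfType) (r i j : nat) (mu : R)
    (x : G_rij r i j -> R) :
  let q : R := (2 + r%:R - mu) * (1 - mu) in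
  mu < 1 -> (q + i%:R * (1 - mu)) * (q + j%:R * (1 - mu)) != i%:R * j%:R ->
  \sum_v x v = 0 -> (forall v, laplace x v = mu * x v) -> forall v, x v = 0.
Proof.
move=> q mu1 qij S0 Lx.
have e0 : 1 - mu != 0 by lra.
have LE (v : G_rij r i j) : (edge v (inl true))%:R * (x v - x (inl true))
    + (edge v (inl false))%:R * (x v - x (inl false))
    + (\sum_s (edge v (inr (inl s)))%:R * (x v - x (inr (inl s)))
       + (\sum_s (edge v (inr (inr (inl s))))%:R * (x v - x (inr (inr (inl s))))
          + \sum_s (edge v (inr (inr (inr s))))%:R * (x v - x (inr (inr (inr s))))))
    = mu * x v.
  by rewrite -Lx /laplace !big_sumType big_bool.
pose a := x (inl false); pose b := x (inl true).
pose Z := \sum_s x (inr (inl s)).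
pose Y := \sum_s x (inr (inr (inl s))); pose W := \sum_s x (inr (inr (inr s))).
have yE s : (1 - mu) * x (inr (inr (inl s))) = a.
  have := LE (inr (inr (inl s))); rewrite /= -!mulr_sumr -/a => H; lra.
have wE s : (1 - mu) * x (inr (inr (inr s))) = b.
  have := LE (inr (inr (inr s))); rewrite /= -!mulr_sumr -/b => H; lra.
have zE s : (2 - mu) * x (inr (inl s)) = a + b.
  have := LE (inr (inl s)); rewrite /= -!mulr_sumr -/a -/b => H; lra.
have YE : (1 - mu) * Y = i%:R * a.
  by rewrite mulr_sumr (eq_bigr _ (fun s _ => yE s)) sumr_const card_ord mulr_natl.
have WE : (1 - mu) * W = j%:R * b.
  by rewrite mulr_sumr (eq_bigr _ (fun s _ => wE s)) sumr_const card_ord mulr_natl.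
have SE : b + a + (Z + (Y + W)) = 0 by rewrite -S0 !big_sumType big_bool.
(* The zero sum turns [b + Z + Y] into [- a - W], which eliminates [Z] from the equation at [a];
   likewise at [b]. *)
have aE : (2 + r%:R + i%:R - mu) * a = - W.
  have := LE (inl false); rewrite /= -!mulr_sumr !sumrB !sumr_const !card_ord.
  rewrite -!(mulr_natl (x _)) -/a -/b -/Z -/Y -/W => H; lra.
have bE : (2 + r%:R + j%:R - mu) * b = - Y.
  have := LE (inl true); rewrite /= -!mulr_sumr !sumrB !sumr_const !card_ord.
  rewrite -!(mulr_natl (x _)) -/a -/b -/Z -/Y -/W => H; lra.
have aE' : (q + i%:R * (1 - mu)) * a + j%:R * b = 0.
  by rewrite -WE -[W]opprK -aE /q; ring.
have bE' : (q + j%:R * (1 - mu)) * b + i%:R * a = 0.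
  by rewrite -YE -[Y]opprK -bE /q; ring.
have det0 : (q + i%:R * (1 - mu)) * (q + j%:R * (1 - mu)) - i%:R * j%:R != 0.
  by rewrite subr_eq0.
(* Cramer's rule for the system [aE'], [bE']. *)
have a0 : a = 0.
  apply: (mulfI det0); rewrite mulr0.
  transitivity ((q + j%:R * (1 - mu)) * ((q + i%:R * (1 - mu)) * a + j%:R * b)
                - j%:R * ((q + j%:R * (1 - mu)) * b + i%:R * a)); first by ring.
  by rewrite aE' bE' !mulr0 subrr.
have b0 : b = 0.
  apply: (mulfI det0); rewrite mulr0.
  transitivity ((q + i%:R * (1 - mu)) * ((q + j%:R * (1 - mu)) * b + i%:R * a)
                - i%:R * ((q + i%:R * (1 - mu)) * a + j%:R * b)); first by ring.
  by rewrite aE' bE' !mulr0 subrr.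
have mu2 : 2 - mu != 0 by lra.
case=> [[]|[s|[s|s]]]; [exact: b0|exact: a0| | |].
- by apply: (mulfI mu2); rewrite zE a0 b0 addr0 mulr0.
- by apply: (mulfI e0); rewrite yE a0 mulr0.
- by apply: (mulfI e0); rewrite wE b0 mulr0.
Qed.

Theorem theorem3p8 (R : rcfType) (r i j : nat) :
  let G := G_rij r i j in
  let n : R := (i + j + r + 2)%:R in
  let k : R := #|D G|%:R / 2 in
  lambda R G 2 >=
    (n - k + 1 - Num.sqrt ((n - k + 1) ^+ 2 - 4 * (n - 2 * k))) / 2.
Proof.
cbv zeta; set G := G_rij r i j; set n : R := (_ + 2)%:R.
set k : R := #|_|%:R / 2; set c : R := (n - k + 1 - _) / 2.
have r0 : 0 <= r%:R :> R by rewrite ler0n.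
have i0 : 0 <= i%:R :> R by rewrite ler0n.
have j0 : 0 <= j%:R :> R by rewrite ler0n.
have k0 : 0 <= k by rewrite divr_ge0 ?ler0n.
have nE : n = i%:R + j%:R + r%:R + 2 by rewrite /n !natrD.
set disc := (n - k + 1) ^+ 2 - 4 * (n - 2 * k) in c *.
(* The difference of the two sides is [4 k]. *)
have discE : (n - k - 1) ^+ 2 <= disc by rewrite -subr_ge0 /disc; lra.
have disc0 : 0 <= disc by apply: le_trans discE; rewrite sqr_ge0.
have c1 : c <= 1.
  have := ler_wsqrtr discE; rewrite sqrtr_sqr => /(le_trans (ler_norm _)).
  rewrite /c; lra.
have cardG : #|G| = (i + j + r + 2)%N by rewrite card_G_rij.
apply: lambda2_ge => [||mu x muc].
- by rewrite cardG addn2.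
- by rewrite cardG -/n nE; lra.
have mu1 : mu < 1 by lra.
apply: G_rij_eigenvector_eq0 => //.
set q : R := _ * (1 - mu).
have q0 : 0 < q by apply: mulr_gt0; lra.
rewrite gt_eqF //.
have [/andP[ipos jpos]|ij0] := boolP ((0 < i)%N && (0 < j)%N); last first.
  have -> : i%:R * j%:R = 0 :> R.
    by case/nandP: ij0; rewrite -eqn0Ngt => /eqP->; rewrite ?mul0r ?mulr0.
  by rewrite mulr_gt0 // ltr_pwDl // mulr_ge0; lra.
(* [c] is the smaller root of this quadratic in [mu]. *)
have quad : 0 < mu ^+ 2 - (n - k + 1) * mu + (n - 2 * k).
  have sq : Num.sqrt disc < n - k + 1 - 2 * mu by move: muc; rewrite /c; lra.
  have := le_lt_trans (sqrtr_ge0 _) sq => sq0.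
  move: sq; rewrite -(ltr_pXn2r (ltn0Sn 1)) ?nnegrE ?sqrtr_ge0 ?ltW //.
  rewrite sqr_sqrtr // /disc; lra.
have kij : i%:R + j%:R <= 2 * k.
  have := leq_card_D_G_rij r _ _ ipos jpos; rewrite -(ler_nat R) natrD /k; lra.
pose h : R := (i%:R + j%:R) / 2.
have qh : h * mu < q.
  (* Replacing [k] by [h] in [quad] gives exactly [q - h mu] and increases the value by this
     product. *)
  have : 0 <= (k - h) * (2 - mu) by apply: mulr_ge0; rewrite ?/h; lra.
  move: quad; rewrite nE /q /h; lra.
rewrite -subr_gt0.
(* The determinant is [q^2 + 2 h q (1 - mu) - i j mu (2 - mu)]. For [mu <= 0] no term is negative;
   for [mu > 0], substituting [i j = h^2 - ((i - j) / 2)^2] makes the part in [h] factor, with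
   [q - h mu] as a factor. *)
have [mu0|mu0] := leP mu 0.
  have -> : (q + i%:R * (1 - mu)) * (q + j%:R * (1 - mu)) - i%:R * j%:R
    = q ^+ 2 + q * (1 - mu) * (i%:R + j%:R) + i%:R * j%:R * ((- mu) * (2 - mu)).
    by ring.
  have ? : 0 <= q * (1 - mu) * (i%:R + j%:R) by rewrite !mulr_ge0; lra.
  have ? : 0 <= i%:R * j%:R * (- mu * (2 - mu)) by rewrite !mulr_ge0 //; lra.
  by have := exprn_gt0 2 q0; lra.
have -> : (q + i%:R * (1 - mu)) * (q + j%:R * (1 - mu)) - i%:R * j%:R
  = (q - h * mu) * (q + h * (2 - mu)) + ((i%:R - j%:R) / 2) ^+ 2 * (mu * (2 - mu)).
  by rewrite /h; field.
have ? : 0 <= h * (2 - mu) by apply: mulr_ge0; rewrite ?/h; lra.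
have ? : 0 < (q - h * mu) * (q + h * (2 - mu)) by apply: mulr_gt0; lra.
have ? : 0 <= ((i%:R - j%:R) / 2) ^+ 2 * (mu * (2 - mu)).
  by rewrite mulr_ge0 ?sqr_ge0 // mulr_ge0; lra.
lra.
Qed.
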